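(* Let $(G,N,\odot)$ and $(G',N',\odot')$ be (finite) skew bracoids and let $(\varphi,\varphi_N):(G,N,\odot)\to(G',N',\odot')$ be a homomorphism of skew bracoids. Then (1) $\ker(\varphi_N)$ is an ideal of $(G,N)$; (2) $(\mathrm{Im}(\varphi),\mathrm{Im}(\varphi_N))$ is a subskew bracoid of $(G',N')$.
   Context: All groups are finite. A (left) skew bracoid is a $5$-tuple $(G,\cdot,N,\star,\odot)$, also written $(G,N,\odot)$ or $(G,N)$, such that $(G,\cdot)$ and $(N,\star)$ are groups and $\odot$ is a transitive action of $(G,\cdot)$ on the set $N$ such that $g\odot(\eta\star\mu)=(g\odot\eta)\star(g\odot e_N)^{-1}\star(g\odot\mu)$ for all $g\in G$ and $\eta,\mu\in N$, where $e_N$ is the identity of $N$ and inverses of elements of $N$ are taken in $(N,\star)$. Its $\gamma$-function is the homomorphism $\gamma:G\to\mathrm{Aut}(N)$ given by ${}^{\gamma(g)}\eta=(g\odot e_N)^{-1}\star(g\odot\eta)$. A left ideal of $(G,N)$ is a subgroup $M$ of $N$ with ${}^{\gamma(G)}M=M$; an ideal is a left ideal that is normal in $N$. A subskew bracoid of $(G,N)$ consists of a subgroup $H$ of $G$ and a subgroup $M$ of $N$ such that $(H,M)$, with the restricted operations and action, is a skew bracoid. A homomorphism of skew bracoids $(G,N,\odot)\to(G',N',\odot')$ is a pair of group homomorphisms $\varphi:G\to G'$ and $\varphi_N:N\to N'$ such that $\varphi_N(g\odot\eta)=\varphi(g)\odot'\varphi_N(\eta)$ for all $g\in G$, $\eta\in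 N$. *)

(* Defs.v *)
From mathcomp Require Import all_boot all_fingroup.

Set Implicit Arguments.
Unset Strict Implicit.
Unset Printing Implicit Defensive.

Local Open Scope group_scope.

(* The groups are subgroups G, N of ambient finite group types, and
   odot : gT -> nT -> nT is only constrained on G x N.  Restricting the
   operations and the action to subgroups H of G and M of N thus amounts to
   using the same predicate with H and M.  The action is a left action,
   whereas the library's {action aT &-> T} are right actions. *)
Record skew_bracoid (gT nT : finGroupType) (G : {group gT}) (N : {group nT})
    (odot : gT -> nT -> nT) : Prop := SkewBracoid {
  sb_closed : forall g eta, g \in G -> eta \in N -> odot g eta \in N;
  sb_act1 : forall eta, eta \in N -> odot 1 eta = eta;
  sb_actM : forall g h eta, g \in G -> h \in G -> eta \in N ->
    odot (g * h) eta = odot g (odot h eta);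
  sb_trans : forall eta mu, eta \in N -> mu \in N ->
    exists2 g, g \in G & odot g eta = mu;
  sb_compat : forall g eta mu, g \in G -> eta \in N -> mu \in N ->
    odot g (eta * mu) = odot g eta * (odot g 1)^-1 * odot g mu
}.

Definition sb_gamma (gT nT : finGroupType) (odot : gT -> nT -> nT)
    (g : gT) (eta : nT) : nT :=
  (odot g 1)^-1 * odot g eta.

Definition left_ideal (gT nT : finGroupType) (G : {group gT})
    (N : {group nT}) (odot : gT -> nT -> nT) (M : {group nT}) : Prop :=
  M \subset N /\ [set sb_gamma odot g eta | g in G, eta in M] = M.

Definition ideal (gT nT : finGroupType) (G : {group gT})
    (N : {group nT}) (odot : gT -> nT -> nT) (M : {group nT}) : Prop :=
  left_ideal G N odot M /\ M <| N.

Definition subskew_bracoid (gT nT : finGroupType) (G : {group gT})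
    (N : {group nT}) (odot : gT -> nT -> nT)
    (H : {group gT}) (M : {group nT}) : Prop :=
  [/\ H \subset G, M \subset N & skew_bracoid H M odot].

Record skew_bracoid_hom (gT nT gT' nT' : finGroupType)
    (G : {group gT}) (N : {group nT}) (odot : gT -> nT -> nT)
    (G' : {group gT'}) (N' : {group nT'}) (odot' : gT' -> nT' -> nT')
    (phi : {morphism G >-> gT'}) (phiN : {morphism N >-> nT'}) : Prop :=
  SkewBracoidHom {
    sbh_codomG : phi @* G \subset G';
    sbh_codomN : phiN @* N \subset N';
    sbh_equiv : forall g eta, g \in G -> eta \in N ->
      phiN (odot g eta) = odot' (phi g) (phiN eta)
  }.

(* Main.v *)
Require Import Defs.
From mathcomp Require Import all_boot all_fingroup.

Local Open Scope group_scope.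

(** Equivariance together with [phiN 1 = 1] makes [phiN] intertwine the two gamma-functions
    ([sbh_gamma]). Each gamma map fixes the identity, so the kernel of [phiN] is gamma-stable; its
    normality is that of any kernel. On the image, closure and transitivity are transported from
    [(G, N)] by equivariance, while the identities restrict from [(G', N')]. *)

Section Homomorphism.

Set Implicit Arguments.
Unset Strict Implicit.

Lemma sb_gamma_closed (gT nT : finGroupType) (G : {group gT}) (N : {group nT})
    (odot : gT -> nT -> nT) (g : gT) (eta : nT) :
  skew_bracoid G N odot -> g \in G -> eta \in N -> sb_gamma odot g eta \in N.
Proof.
by move=> bGN Gg Neta; rewrite groupM ?groupV ?(sb_closed bGN).
Qed.

Lemma sb_gamma1 (gT nT : finGroupType) (G : {group gT}) (N : {group nT})
    (odot : gT -> nT -> nT) (eta : nT) :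
  skew_bracoid G N odot -> eta \in N -> sb_gamma odot 1 eta = eta.
Proof.
by move=> bGN Neta; rewrite /sb_gamma !(sb_act1 bGN) // invg1 mul1g.
Qed.

Variables (gT nT gT' nT' : finGroupType).
Variables (G : {group gT}) (N : {group nT}) (odot : gT -> nT -> nT).
Variables (G' : {group gT'}) (N' : {group nT'}) (odot' : gT' -> nT' -> nT').
Variables (phi : {morphism G >-> gT'}) (phiN : {morphism N >-> nT'}).
Hypothesis bGN : skew_bracoid G N odot.
Hypothesis bGN' : skew_bracoid G' N' odot'.
Hypothesis hom : skew_bracoid_hom odot G' N' odot' phi phiN.

(** A gamma map is built from the action, the identity, a product and an inverse, all of which
    [phiN] respects inside its domain [N]. *)
Lemma sbh_gamma g eta : g \in G -> eta \in N ->
  phiN (sb_gamma odot g eta) = sb_gamma odot' (phi g) (phiN eta).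
Proof.
move=> Gg Neta; have Ng1 := sb_closed bGN Gg (group1 N).
rewrite /sb_gamma morphM ?groupV ?(sb_closed bGN) // morphV //.
by rewrite !(sbh_equiv hom) // morph1.
Qed.

Lemma sbh_ker_ideal : ideal G N odot ('ker phiN)%G.
Proof.
split; last exact: ker_normal.
split; first exact: subsetIl.
apply/setP=> mu; apply/imset2P/idP=> [[g eta Gg Keta ->] | Kmu].
  have Neta := dom_ker Keta.
  apply/kerP; first exact: sb_gamma_closed bGN Gg Neta.
  (* The image is the gamma map of [phi g] at [1], which is [x^-1 * x] with
     [x = odot' (phi g) 1]. *)
  by rewrite sbh_gamma // (mker Keta) /sb_gamma mulVg.
(* Conversely, the kernel lies in its gamma-image because [1] acts trivially. *)
by exists 1 mu; rewrite ?group1 // (sb_gamma1 bGN) ?(dom_ker Kmu).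
Qed.

Lemma sbh_im_subskew_bracoid :
  subskew_bracoid G' N' odot' (phi @* G)%G (phiN @* N)%G.
Proof.
have sG := subsetP (sbh_codomG hom); have sN := subsetP (sbh_codomN hom).
split; [exact: sbh_codomG hom | exact: sbh_codomN hom | split].
- move=> _ _ /morphimP[g _ Gg ->] /morphimP[eta _ Neta ->].
  by rewrite -(sbh_equiv hom) // mem_morphim ?(sb_closed bGN).
- by move=> eta /sN; apply: (sb_act1 bGN').
- by move=> g h eta /sG G'g /sG G'h /sN; apply: (sb_actM bGN').
- move=> _ _ /morphimP[eta _ Neta ->] /morphimP[mu _ Nmu ->].
  (* An element [g] moving [eta] to [mu] yields [phi g], which moves [phiN eta] to [phiN mu]. *)
  have [g Gg <-] := sb_trans bGN Neta Nmu.
  by exists (phi g); rewrite ?mem_morphim // (sbh_equiv hom).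
- by move=> g eta mu /sG G'g /sN N'eta /sN; apply: (sb_compat bGN').
Qed.

End Homomorphism.

Theorem proposition4p5 (gT nT gT' nT' : finGroupType)
    (G : {group gT}) (N : {group nT}) (odot : gT -> nT -> nT)
    (G' : {group gT'}) (N' : {group nT'}) (odot' : gT' -> nT' -> nT')
    (phi : {morphism G >-> gT'}) (phiN : {morphism N >-> nT'})
    (bGN : skew_bracoid G N odot) (bGN' : skew_bracoid G' N' odot')
    (hom : skew_bracoid_hom odot G' N' odot' phi phiN) :
  ideal G N odot ('ker phiN)%G /\
  subskew_bracoid G' N' odot' (phi @* G)%G (phiN @* N)%G.
Proof.
split; first exact: sbh_ker_ideal bGN hom.
exact: sbh_im_subskew_bracoid bGN bGN' hom.
Qed.
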